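(* For every $\epsilon>0$ there exist constants $c>0$, $C>0$ and $d_0$ (independent of $d$) such that for every $d\ge d_0$ there is a bipartite graph $G=(V,W,E)$ which contains no $K_{2,2}$ as a subgraph, has average degree at least $c\,d^{1-\epsilon}$, and has a conjunctive normal form using at most $C\log d$ clauses.
   Context: A bipartite graph over vertex sets $V$ and $W$ is $G=(V,W,E)$ with $E\subset V\times W$. For two bipartite graphs $G_1=(V,W,E_1)$, $G_2=(V,W,E_2)$ over the same $V,W$, the intersection is $G_1\cap G_2=(V,W,E_1\cap E_2)$, and intersections of families are defined edge-setwise likewise. For $A\subset V$ and $B\subset W$, the clause graph is $CL(A,B)=(V,W,(A\times W)\cup(V\times B))$. Sets $A_1,\dots,A_n\subset V$ and $B_1,\dots,B_n\subset W$ form a conjunctive normal form using $n$ clauses for a graph $G$ over $V$ and $W$ if $G=\bigcap_{i=1}^n CL(A_i,B_i)$. *)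

(* Defs.v *)
From mathcomp Require Import all_boot all_order all_algebra.
From mathcomp Require Import reals exp.

Set Implicit Arguments.
Unset Strict Implicit.
Unset Printing Implicit Defensive.

Import Order.TTheory GRing.Theory Num.Theory.

(* A finite bipartite graph is given by its edge set; the two sides are the
   types V and W, hence always disjoint.  Intersecting graphs over the same
   sides is intersecting sets. *)
Definition bigraph (V W : finType) : finType := {set V * W}.

Section Bigraph.
Variables V W : finType.
Implicit Type G : bigraph V W.

Definition degl G (v : V) : nat := #|[set w | (v, w) \in G]|.
Definition degr G (w : W) : nat := #|[set v | (v, w) \in G]|.

(* The average is over all vertices, of both sides. *)
Definition avg_degree (R : realType) G : R :=
  ((\sum_v degl G v + \sum_w degr G w)%N%:R / (#|V| + #|W|)%N%:R)%R.

(* K_{s,t} with the s vertices in V and the t vertices in W. *)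
Definition has_biclique (s t : nat) G : Prop :=
  exists (S : {set V}) (T : {set W}),
    [/\ #|S| = s, #|T| = t & setX S T \subset G].

Definition clause_graph (A : {set V}) (B : {set W}) : bigraph V W :=
  setX A [set: W] :|: setX [set: V] B.

Definition is_cnf (n : nat) (A : 'I_n -> {set V}) (B : 'I_n -> {set W}) G :
    Prop :=
  G = \bigcap_(i < n) clause_graph (A i) (B i).

End Bigraph.

(* Main.v *)
(** Over a field F, the incidence graph "b = a c + d" between points (a, b) and
    lines (c, d) has no K_{2,2}, because two points on two common lines satisfy
    (a - a') (c - c') = 0.  Read the equation coordinatewise in the ring
    F^(2k): the same conclusion holds as soon as the abscissae a and the slopes
    c are taken from a code whose distinct words differ in more than half of
    the coordinates, since then (a - a') (c - c') has a nonzero coordinate.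
    The degree of every vertex is the size of the code, which by the greedy
    Gilbert-Varshamov argument may be at least 4^k when |F| >= 16, and since
    each coordinate is a condition on a graph of constant size, the number of
    clauses is linear in k. *)
Require Import Defs.
From mathcomp Require Import all_boot all_order all_algebra.
From mathcomp Require Import reals exp.
From mathcomp Require Import ring.

Set Implicit Arguments.
Unset Strict Implicit.
Unset Printing Implicit Defensive.

Import Order.TTheory GRing.Theory Num.Theory.
Local Open Scope ring_scope.

Lemma leq_card_bigcup (I T : finType) (P : pred I) (B : I -> {set T}) :
  (#|\bigcup_(i | P i) B i| <= \sum_(i | P i) #|B i|)%N.
Proof.
elim/big_ind2: _ => [|A m B' n leA leB|i _]; rewrite ?cards0 //.
by apply: leq_trans (leq_add leA leB); apply: leq_card_setU.
Qed.

Section Codes.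
Variables I Q : finType.
Local Open Scope nat_scope.
Implicit Types (x y : {ffun I -> Q}) (C : {set {ffun I -> Q}}).

Definition diff_supp x y : {set I} := [set i | x i != y i].

Definition min_dist_gt (r : nat) C : Prop :=
  {in C &, forall x y, x != y -> r < #|diff_supp x y|}.

(** A word of the ball agrees with [x] off some set of at most [r] coordinates; [2 ^ #|I|] crudely
    bounds the number of such sets, and each leaves at most [#|Q| ^ r] words. *)
Lemma card_hamming_ball r x : 0 < #|Q| ->
  #|[set y | #|diff_supp x y| <= r]| <= 2 ^ #|I| * #|Q| ^ r.
Proof.
move=> Q_gt0.
pose F (S : {set I}) i := if i \in S then [set: Q] else [set x i].
have sub : [set y | #|diff_supp x y| <= r] \subset
    \bigcup_(S : {set I} | #|S| <= r) [set y in family (F S)].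
  apply/subsetP => y; rewrite inE => le_r; apply/bigcupP.
  exists (diff_supp x y) => //; rewrite inE; apply/familyP => i.
  by rewrite /F inE; case: eqP => [->|_]; rewrite inE.
apply: leq_trans (subset_leq_card sub) _.
apply: leq_trans (leq_card_bigcup _ _) _ => /=.
apply: (@leq_trans (\sum_(S : {set I} | #|S| <= r) #|Q| ^ r)).
  apply: leq_sum => S le_r; rewrite cardsE card_family foldrE big_map big_enum.
  rewrite (bigID (mem S)) /= [X in _ * X]big1 ?muln1; last first.
    by move=> i /negbTE iS; rewrite /F iS cards1.
  rewrite (eq_bigr (fun=> #|Q|)); last by move=> i iS; rewrite /F iS cardsT.
  by rewrite prod_nat_const leq_pexp2l.
rewrite sum_nat_const leq_mul2r; apply/orP; right.
rewrite -[#|I|]cardsT -card_powerset powersetT cardsT.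
exact: max_card.
Qed.

(** The balls of radius [r] around the words of a maximal code cover the whole space, since an
    uncovered word could be added to the code. *)
Lemma gilbert_varshamov r : 0 < #|Q| ->
  exists2 C, min_dist_gt r C &
    #|Q| ^ #|I| <= #|C| * (2 ^ #|I| * #|Q| ^ r).
Proof.
move=> Q_gt0.
pose P C := [forall x in C, forall y in C, (x != y) ==> (r < #|diff_supp x y|)].
have [C /maxsetP[PC Cmax]] : {C | maxset P C}.
  by apply: ex_maxset; exists set0; apply/forall_inP => x; rewrite inE.
have {}PC : min_dist_gt r C.
  by move=> x y xC yC; move/forall_inP/(_ x xC)/forall_inP/(_ y yC)/implyP: PC.
have diff_suppC x y : diff_supp x y = diff_supp y x.
  by apply/setP => i; rewrite !inE eq_sym.
have diff_suppxx x : diff_supp x x = set0.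
  by apply/setP => i; rewrite !inE eqxx.
exists C => //; rewrite -card_ffun -[X in (X <= _)%N]cardsT.
have cover_balls : [set: {ffun I -> Q}] \subset
    \bigcup_(x in C) [set y | #|diff_supp x y| <= r].
  apply/subsetP => y _; apply/bigcupP.
  have [yC|yC] := boolP (y \in C).
    by exists y => //; rewrite inE diff_suppxx cards0.
  have [/exists_inP[x xC le_r]|] :=
    boolP [exists x in C, #|diff_supp x y| <= r].
    by exists x => //; rewrite inE.
  rewrite negb_exists_in => /forall_inP far.
  case/negP: yC; rewrite -[C](Cmax (y |: C)) ?setU11 ?subsetUr //.
  apply/forall_inP => x1; rewrite !inE => /orP x1P.
  apply/forall_inP => x2; rewrite !inE => /orP x2P.
  apply/implyP => x12; case: x1P x2P x12 => [/eqP->|x1C] [/eqP->|x2C].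
  - by rewrite eqxx.
  - by move=> _; rewrite diff_suppC ltnNge far.
  - by move=> _; rewrite ltnNge far.
  - exact: PC.
apply: leq_trans (subset_leq_card cover_balls) _.
apply: leq_trans (leq_card_bigcup _ _) _ => /=.
rewrite -sum_nat_const; apply: leq_sum => x _.
exact: card_hamming_ball.
Qed.

End Codes.

(** Allows clauses to be indexed by a coordinate together with a pair of field elements. *)
Lemma is_cnf_finType (V W T : finType) (A : T -> {set V}) (B : T -> {set W})
    (G : bigraph V W) :
  G = \bigcap_t clause_graph (A t) (B t) ->
  exists (A' : 'I_#|T| -> {set V}) (B' : 'I_#|T| -> {set W}), is_cnf A' B' G.
Proof.
move=> ->; exists (A \o enum_val), (B \o enum_val); rewrite /is_cnf.
by rewrite (reindex (@enum_val T predT)) //; apply: onW_bij; apply: enum_val_bij.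
Qed.

Section Incidence.
Variables (F : finFieldType) (I : finType) (C : {set {ffun I -> F}}).

Local Notation side := ({x | x \in C} * {ffun I -> F})%type.

(** Only abscissae and slopes are confined to the code: with the second components free, each
    codeword completes to exactly one neighbour of a given vertex. *)
Definition incidence : bigraph side side :=
  [set e : side * side |
    [forall i, e.1.2 i == val e.1.1 i * val e.2.1 i + e.2.2 i]].

Lemma incidenceP (v w : side) :
  reflect (forall i, v.2 i = val v.1 i * val w.1 i + w.2 i)
    ((v, w) \in incidence).
Proof. by rewrite inE; apply: (iffP forallP) => h i; apply/eqP/h. Qed.

(** The clause at [(i, (a, b))] is an implication: if [v] has the values [(a, b)] at [i], then [w]
    satisfies the equation there. The premise concerns [v] alone and the conclusion [w] alone. *)
Lemma incidence_cnf :
  exists (A B : 'I_#|{: I * (F * F)}| -> {set side}), is_cnf A B incidence.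
Proof.
pose A (t : I * (F * F)) := [set v : side | (val v.1 t.1, v.2 t.1) != t.2].
pose B (t : I * (F * F)) :=
  [set w : side | t.2.2 == t.2.1 * val w.1 t.1 + w.2 t.1].
apply: (@is_cnf_finType _ _ _ A B); apply/setP => -[v w].
apply/incidenceP/bigcapP => [vw [i [a b]] _|vw i].
  rewrite !inE /= andbT -implybE; apply/implyP => /eqP[<- <-].
  exact/eqP.
have := vw (i, (val v.1 i, v.2 i)) isT.
by rewrite !inE /= eqxx /= => /eqP.
Qed.

Lemma incidence_degl v : (#|C| <= degl incidence v)%N.
Proof.
pose f (c : {x | x \in C}) : side := (c, [ffun i => v.2 i - val v.1 i * val c i]).
have f_inj : injective f by move=> c c' [].
rewrite -[#|C|]card_sig -(card_codom f_inj); apply: subset_leq_card.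
apply/subsetP => _ /codomP[c ->]; rewrite inE; apply/incidenceP => i /=.
by rewrite ffunE addrC subrK.
Qed.

Lemma incidence_degr w : (#|C| <= degr incidence w)%N.
Proof.
pose f (a : {x | x \in C}) : side := (a, [ffun i => val a i * val w.1 i + w.2 i]).
have f_inj : injective f by move=> c c' [].
rewrite -[#|C|]card_sig -(card_codom f_inj); apply: subset_leq_card.
apply/subsetP => _ /codomP[c ->]; rewrite inE; apply/incidenceP => i /=.
by rewrite ffunE.
Qed.

Lemma incidence_avg_degree (R : realType) :
  (0 < #|C|)%N -> #|C|%:R <= avg_degree R incidence.
Proof.
move=> /card_gt0P[x xC].
have side_gt0 : (0 < #|{: side}|)%N.
  by apply/card_gt0P; exists (exist _ x xC, [ffun=> 0]).
rewrite /avg_degree ler_pdivlMr ?ltr0n ?addn_gt0 ?side_gt0 //.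
rewrite -natrM ler_nat mulnDr; apply: leq_add; rewrite mulnC -sum_nat_const.
  by apply: leq_sum => v _; apply: incidence_degl.
by apply: leq_sum => w _; apply: incidence_degr.
Qed.

Lemma incidence_K22_free (r : nat) :
  min_dist_gt r C -> (#|I| <= r.*2)%N -> ~ has_biclique 2 2 incidence.
Proof.
move=> Cdist le_r [S [T [/eqP/cards2P[v [v' [vv' ->]]] /eqP/cards2P]]].
case=> [w [w' [ww' ->]]] /subsetP sub.
have edge x y : x \in [set v; v'] -> y \in [set w; w'] ->
    forall i, x.2 i = val x.1 i * val y.1 i + y.2 i.
  by move=> xS yT; apply/incidenceP/sub; rewrite in_setX xS.
have vw := edge v w (set21 _ _) (set21 _ _).
have vw' := edge v w' (set21 _ _) (set22 _ _).
have v'w := edge v' w (set22 _ _) (set21 _ _).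
have v'w' := edge v' w' (set22 _ _) (set22 _ _).
(* A common neighbour and the first component determine the second, so distinct vertices on one side
   have distinct codewords. *)
have nv1 : val v.1 != val v'.1.
  apply: contra vv' => /eqP v1E; rewrite -pair_eqE /pair_eq /= -val_eqE v1E eqxx.
  by apply/eqP/ffunP => i; rewrite vw v'w v1E.
have nw1 : val w.1 != val w'.1.
  apply: contra ww' => /eqP w1E; rewrite -pair_eqE /pair_eq /= -val_eqE w1E eqxx.
  apply/eqP/ffunP => i; apply: (addrI (val v.1 i * val w.1 i)).
  by rewrite -vw w1E -vw'.
set D := diff_supp (val v.1) (val v'.1); set E := diff_supp (val w.1) (val w'.1).
have gtD : (r < #|D|)%N by apply: Cdist => //; apply: valP.
have gtE : (r < #|E|)%N by apply: Cdist => //; apply: valP.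
(* Disjoint supports would occupy more than [r.*2] coordinates. *)
have [DE0|[i]] := set_0Vmem (D :&: E).
  have := max_card (D :|: E); rewrite cardsU DE0 cards0 subn0.
  move=> /leq_trans/(_ le_r); rewrite leqNgt -addnn => /negP; apply.
  by rewrite -addnS leq_add // ltnW.
rewrite !inE -subr_eq0 -[val w.1 i == _]subr_eq0 => /andP[Di Ei].
have /eqP[] : (val v.1 i - val v'.1 i) * (val w.1 i - val w'.1 i) != 0.
  by rewrite mulf_neq0.
(* In the alternating sum of the four edge equations all second components cancel. *)
have -> : (val v.1 i - val v'.1 i) * (val w.1 i - val w'.1 i) =
  (val v.1 i * val w.1 i + w.2 i) - (val v.1 i * val w'.1 i + w'.2 i)
  - (val v'.1 i * val w.1 i + w.2 i) + (val v'.1 i * val w'.1 i + w'.2 i).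
  by ring.
by rewrite -vw -vw' -v'w -v'w' subrr sub0r addNr.
Qed.

End Incidence.

Lemma K22_free_cnf (R : realType) (F : finFieldType) (k : nat) :
  (16 <= #|F|)%N ->
  exists (V W : finType) (G : bigraph V W),
    [/\ ~ has_biclique 2 2 G, (4 ^ k)%:R <= avg_degree R G &
      exists (A : 'I_(k.*2 * (#|F| * #|F|)) -> {set V})
             (B : 'I_(k.*2 * (#|F| * #|F|)) -> {set W}), is_cnf A B G].
Proof.
move=> F16; have F0 : (0 < #|F|)%N by apply: leq_trans F16.
have [C Cdist] := @gilbert_varshamov 'I_k.*2 F k F0.
move=> leC; have {}leC : (4 ^ k <= #|C|)%N.
  have le16 : (16 ^ k <= #|F| ^ k)%N by case: (k) => // j; rewrite leq_exp2r.
  have cardI : #|'I_k.*2| = (k + k)%N by rewrite card_ord addnn.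
  (* Cancelling [#|F| ^ k] leaves [#|F| ^ k <= #|C| * 4 ^ k]; the bound 16 on the field supplies a
     second factor [4 ^ k] on the left. *)
  move: leC; rewrite cardI !expnD mulnA leq_pmul2r ?expn_gt0 ?F0 //.
  move=> /(leq_trans le16).
  rewrite -[(2 ^ k * _)%N]expnMn -[16%N]/(4 * 4)%N expnMn.
  by rewrite leq_pmul2r ?expn_gt0.
have -> : (k.*2 * (#|F| * #|F|))%N = #|{: 'I_k.*2 * (F * F)}|.
  by rewrite !card_prod card_ord.
exists _, _, (incidence C); split.
- by apply: incidence_K22_free Cdist _; rewrite card_ord.
- apply: le_trans (incidence_avg_degree R _); first by rewrite ler_nat.
  by apply: leq_trans leC; rewrite expn_gt0.
- exact: incidence_cnf.
Qed.

Theorem theorem1p2 (R : realType) (eps : R) (eps_gt0 : 0 < eps) :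
  exists c C d0 : R,
    [/\ 0 < c, 0 < C &
      forall d : R, d0 <= d ->
        exists (V W : finType) (G : bigraph V W),
          [/\ ~ has_biclique 2 2 G,
              c * d `^ (1 - eps) <= avg_degree R G &
              exists (n : nat) (A : 'I_n -> {set V}) (B : 'I_n -> {set W}),
                n%:R <= C * ln d /\ is_cnf A B G]].
Proof.
have ln4_gt0 : 0 < ln 4 :> R by rewrite ln_gt0 // ltr1n.
pose q := #|'F_17|.
have q16 : (16 <= q)%N by rewrite /q card_Fp.
have q_gt0 : (0 < q)%N by apply: leq_trans q16.
(* There will be [2 * k * q ^ 2] clauses with [k] at most twice the base 4 logarithm of [d];
   starting at [d = 4] makes this logarithm at least 1, which absorbs rounding up. *)
exists 1, ((4 * (q * q))%N%:R / ln 4), 4; split=> //.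
  by rewrite divr_gt0 // ltr0n !muln_gt0 q_gt0.
move=> d le4d; have d_gt0 : 0 < d by apply: lt_le_trans le4d.
have d_ge1 : 1 <= d by apply: le_trans le4d; rewrite ler1n.
set x := ln d / ln 4; pose k := (Num.truncn x).+1.
have x_ge1 : 1 <= x by rewrite ler_pdivlMr // mul1r ler_ln // posrE.
have le_k : k%:R <= 2 * x.
  rewrite -[k%:R]natr1 mulr_natl mulr2n lerD // truncn_le.
  exact: le_trans x_ge1.
have le_d : d <= (4 ^ k)%:R.
  rewrite natrX -ler_ln ?posrE ?exprn_gt0 // lnXn // -[leRHS]mulr_natl -ler_pdivrMr //.
  by rewrite ltW // truncnS_gt.
have [V [W [G [free deg [A [B cnf]]]]]] := K22_free_cnf R k q16.
exists V, W, G; split=> //.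
  (* The average degree is at least [d] itself, which dominates the power because [1 <= d] and
     [0 < eps]. *)
  rewrite mul1r; apply: le_trans deg; apply: le_trans le_d.
  by rewrite ler1_powR // gerBl ltW.
exists (k.*2 * (q * q))%N, A, B; split=> //.
have -> : (4 * (q * q))%N%:R / ln 4 * ln d = (2 * (q * q))%N%:R * (2 * x).
  by rewrite /x !natrM; ring.
by rewrite -muln2 -mulnA natrM mulrC ler_wpM2l.
Qed.
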